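(* Let $a>0$ and let $n\ge1$ be an integer. Then the polynomial $Q_n$ is of extremal growth at $z_0=ai$ relative to $K=[-1,1]$. Specifically, $$Q_n(z)=-i^n\,P_n^{\mu_0,z_0}(z),$$ where $\mu_0$ is the discrete probability measure supported on $\pm1$ together with the $n-1$ zeros of $R_{n-1}$, with the optimal weights $w_k=|\ell_k(z_0)|/\sum_{j=0}^n|\ell_j(z_0)|$.
   Context: For $a>0$ the polynomials $Q_n$ ($n\ge1$) and $R_n$ ($n\ge0$) are defined by $$Q_1(z)=-\frac{az+i}{\sqrt{a^2+1}},\quad Q_2(z)=\frac{-(a+\sqrt{a^2+1})z^2-iz+\sqrt{a^2+1}}{\sqrt{a^2+1}},\quad Q_{n+1}(z)=2zQ_n(z)-Q_{n-1}(z)\ (n\ge2),$$ $$R_0(z)=\frac{a}{\sqrt{a^2+1}},\quad R_1(z)=\frac{a+\sqrt{a^2+1}}{\sqrt{a^2+1}}\,z,\quad R_{n+1}(z)=2zR_n(z)-R_{n-1}(z)\ (n\ge1).$$ The polynomial $R_{n-1}$ has $n-1$ distinct zeros, all in $(-1,1)$. Write $-1=x_0<x_1<\cdots<x_n=1$ for the points consisting of $\pm1$ and these zeros, and let $\ell_k$ be the Lagrange polynomials of degree $n$ with $\ell_k(x_j)=\delta_{kj}$; then $\mu_0=\sum_{k=0}^n w_k\delta_{x_k}$. $\mathbb{C}_n[z]$ is the space of complex polynomials of degree at most $n$ in one variable. For a probability measure $\mu$ on $[-1,1]$ and a $\mu$-orthonormal basis $q_0,\dots,q_n$ of $\mathbb{C}_n[z]$,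 $K_n^\mu(w,z)=\sum_{k=0}^n\overline{q_k(w)}q_k(z)$ and $P_n^{\mu,z_0}(z)=K_n^\mu(z_0,z)/\sqrt{K_n^\mu(z_0,z_0)}$. A polynomial $P\in\mathbb{C}_n[z]$ is of extremal growth at $z_0$ relative to $K$ if $\|P\|_K:=\sup_K|P|\le1$ and $|P(z_0)|=\max_{p\in\mathbb{C}_n[z],\,\|p\|_K\le1}|p(z_0)|$. *)

(* Defs.v *)
From HB Require Import structures.
From mathcomp Require Import all_boot all_order all_algebra.
From mathcomp Require Import qpoly polyrcf complex.
From mathcomp Require Import all_classical all_reals all_analysis.

Set Implicit Arguments.
Unset Strict Implicit.
Unset Printing Implicit Defensive.

Import Order.TTheory GRing.Theory Num.Theory.

Local Open Scope classical_set_scope.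
Local Open Scope ring_scope.

Section Polynomials.
Context {R : realType}.
Implicit Types (a : R) (n : nat).

(* The index 0 is a junk value: the sequence starts at Q_1. *)
Fixpoint Qpoly a n : {poly R[i]} :=
  let s : R := Num.sqrt (a ^+ 2 + 1) in
  match n with
  | 0 => 0
  | n1.+1 =>
    match n1 with
    | 0 => - ((s%:C)%C^-1 *: ((a%:C)%C *: 'X + (('i)%C : R[i])%:P))
    | n2.+1 =>
      match n2 with
      | 0 => (s%:C)%C^-1 *:
          (- ((a + s)%:C)%C *: 'X^2 - (('i)%C : R[i]) *: 'X + ((s%:C)%C)%:P)
      | _.+1 => 2%:R *: 'X * Qpoly a n1 - Qpoly a n2
      end
    end
  end.

(* The R_n have real coefficients, and all their zeros are real. *)
Fixpoint Rpoly a n : {poly R} :=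
  let s : R := Num.sqrt (a ^+ 2 + 1) in
  match n with
  | 0 => (a / s)%:P
  | n1.+1 =>
    match n1 with
    | 0 => ((a + s) / s) *: 'X
    | n2.+1 => 2%:R *: 'X * Rpoly a n1 - Rpoly a n2
    end
  end.

End Polynomials.

Section ExtremalGrowth.
Context {R : realType}.
Implicit Types (K : set R[i]).

Definition supnorm K (p : {poly R[i]}) : \bar R :=
  ereal_sup [set (Normc.normc p.[z])%:E | z in K].

Definition extremal_growth (n : nat) (z0 : R[i]) K (P : {poly R[i]}) : Prop :=
  [/\ (size P <= n.+1)%N, (supnorm K P <= 1)%E &
    forall p : {poly_n.+1 R[i]}, (supnorm K p <= 1)%E ->
      Normc.normc (p : {poly R[i]}).[z0] <= Normc.normc P.[z0]].

Definition segment11 : set R[i] := [set (x%:C)%C | x in `[(-1 : R), 1]].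

End ExtremalGrowth.

Section ChristoffelDarbouxKernel.
Context {R : realType}.
Variable mu : {measure set (measurableTypeR R) -> \bar R}.

Definition cintegral (D : set R) (f : R -> R[i]) : R[i] :=
  (Rintegral mu D (fun x => complex.Re (f x))
     +i* Rintegral mu D (fun x => complex.Im (f x)))%C.

Definition inner (p r : {poly R[i]}) : R[i] :=
  cintegral `[(-1 : R), 1] (fun x => p.[(x%:C)%C] * (r.[(x%:C)%C])^*).

Definition orthonormal_basis n (q : n.+1.-tuple {poly_n.+1 R[i]}) : Prop :=
  basis_of fullv q /\
  forall j k : 'I_n.+1, inner (tnth q j) (tnth q k) = (j == k)%:R.

End ChristoffelDarbouxKernel.

Section ReproducingKernel.
Context {R : realType} {n : nat}.
Variable q : n.+1.-tuple {poly_n.+1 R[i]}.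

Definition CDkernel (w z : R[i]) : R[i] :=
  \sum_(k < n.+1) ((tnth q k : {poly R[i]}).[w])^*
                   * (tnth q k : {poly R[i]}).[z].

Definition Pextremal (z0 z : R[i]) : R[i] :=
  CDkernel z0 z / sqrtC (CDkernel z0 z0).

End ReproducingKernel.

Section OptimalMeasure.
Context {R : realType}.
Variables (a : R) (n : nat).

Definition z0_of : R[i] := (0 +i* a)%C.

(* [rootsR] lists the real roots of a nonzero polynomial in increasing order,
   without repetition.  As R_(n-1) has n-1 zeros, all in ]-1, 1[, the sequence
   below has size n+1 and is increasing; the default of [nth] is only reached
   for k > n. *)
Definition node (k : nat) : R :=
  nth 1 (-1 :: rcons (rootsR (Rpoly a n.-1)) 1) k.

Definition ell (k : 'I_n.+1) : {poly_n.+1 R[i]} :=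
  tnth (lagrange n.+1 (fun j : nat => ((node j)%:C)%C)) k.

Definition ell_abs (k : 'I_n.+1) : R :=
  Normc.normc (ell k : {poly R[i]}).[z0_of].

Definition weight (k : 'I_n.+1) : R := ell_abs k / \sum_(j < n.+1) ell_abs j.

Lemma ell_abs_ge0 k : 0 <= ell_abs k.
Proof. by rewrite /ell_abs; case: _.[_] => x y /=; exact: sqrtr_ge0. Qed.

Lemma weight_ge0 k : 0 <= weight k.
Proof.
by rewrite divr_ge0 ?ell_abs_ge0// sumr_ge0// => j _; exact: ell_abs_ge0.
Qed.

Definition mu0 : {measure set (measurableTypeR R) -> \bar R} :=
  msum (fun k : nat => mscale (NngNum (weight_ge0 (inord k)))
                        (@dirac _ (measurableTypeR R) (node k) R)) n.+1.

End OptimalMeasure.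

(* Main.v *)
(* The equality case of Lagrange interpolation. Write s = sqrt (a^2 + 1),
   b = a / s, m = n - 1. With Chebyshev polynomials T = T_m and U = U_(m-1),
     R_m = b T + X U,  Re Q_n = (1 - X^2) U - b X T,  Im Q_n = - T / s
   on the real line, so Pell's identity T^2 + (1 - X^2) U^2 = 1 gives
     |Q_n|^2 + (1 - X^2) R_m^2 = 1,  X Re Q_n - a Im Q_n = (1 - X^2) R_m.
   Hence |Q_n| <= 1 on [-1, 1] and, at a node x_k, |Q_n(x_k)| = 1 and Q_n(x_k)
   is a real multiple of a + i x_k. Its sign is found from the derivative of
   W = (1 - X^2) R_m, because Re Q_n * W' > 0 at the nodes; together with
   R_m(ai) = i^m rho, rho > 0, this yields
     - i^n conj(l_k(z_0)) = |l_k(z_0)| Q_n(x_k).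
   Interpolating at z_0 shows |Q_n(z_0)| = sum_k |l_k(z_0)|, which bounds
   |p(z_0)| for every competitor p; and the reproducing property says that
   K(z_0, x_k) = conj(l_k(z_0)) / w_k, which identifies K(z_0, .). *)

Require Import Defs.
From mathcomp Require Import all_boot all_order all_algebra.
From mathcomp Require Import qpoly polyrcf complex ring lra.
From mathcomp Require Import all_classical all_reals all_analysis.
From mathcomp Require Import measurable_realfun.

Set Implicit Arguments.
Unset Strict Implicit.
Unset Printing Implicit Defensive.

Import Order.TTheory GRing.Theory Num.Theory.
Import numFieldNormedType.Exports.
Local Open Scope classical_set_scope.
Local Open Scope ring_scope.

(** * Chebyshev polynomials *)

Section Chebyshev.
Context {R : realType}.
Implicit Types (m : nat) (x t : R).

(* [chebTU m] is the pair (T_m, U_(m-1)), with U_(-1) = 0. *)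
Fixpoint chebTU m : {poly R} * {poly R} :=
  if m is m'.+1 then
    let: (t, u) := chebTU m' in ('X * t - (1 - 'X ^+ 2) * u, 'X * u + t)
  else (1, 0).

Definition chebT m := (chebTU m).1.
Definition chebU m := (chebTU m).2.

Lemma chebT0 : chebT 0 = 1. Proof. by []. Qed.
Lemma chebU0 : chebU 0 = 0. Proof. by []. Qed.

Lemma chebTS m : chebT m.+1 = 'X * chebT m - (1 - 'X ^+ 2) * chebU m.
Proof. by rewrite /chebT /chebU /=; case: chebTU. Qed.

Lemma chebUS m : chebU m.+1 = 'X * chebU m + chebT m.
Proof. by rewrite /chebT /chebU /=; case: chebTU. Qed.

Lemma chebTSS m : chebT m.+2 = 2%:R * 'X * chebT m.+1 - chebT m.
Proof. rewrite !(chebTS, chebUS); ring. Qed.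

Lemma chebUSS m : chebU m.+2 = 2%:R * 'X * chebU m.+1 - chebU m.
Proof. rewrite !(chebTS, chebUS); ring. Qed.

(** The recursion of [chebTU] multiplies T + U r, where r^2 = X^2 - 1, by X + r. The norm T^2 - r^2
    U^2 is multiplicative and X + r has norm 1. *)
Lemma cheb_pell m : chebT m ^+ 2 + (1 - 'X ^+ 2) * chebU m ^+ 2 = 1.
Proof.
elim: m => [|m IH]; first by rewrite chebT0 chebU0; ring.
by rewrite chebTS chebUS -[RHS]IH; ring.
Qed.

(** On x = cos t these are the derivatives of cos (m t) and sin (m t), the second one cleared of its
    denominator. Each induction step needs both identities. *)
Lemma cheb_deriv m :
  (chebT m)^`() = m%:R * chebU m /\
  (1 - 'X ^+ 2) * (chebU m)^`() = 'X * chebU m - m%:R * chebT m.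
Proof.
elim: m => [|m [IHt IHu]].
  by rewrite chebT0 chebU0 derivC raddf0; split; ring.
rewrite chebTS chebUS; split.
  rewrite derivB !derivM derivB derivX derivXn derivC IHt.
  by rewrite IHu -natr1 /=; ring.
rewrite derivD derivM derivX IHt -natr1.
transitivity ((1 - 'X ^+ 2) * chebU m + 'X * ((1 - 'X ^+ 2) * (chebU m)^`())
              + (1 - 'X ^+ 2) * (m%:R * chebU m)); first by ring.
rewrite IHu; ring.
Qed.

Lemma cheb_cos m t :
  (chebT m).[cos t] = cos (m%:R * t) /\
  sin t * (chebU m).[cos t] = sin (m%:R * t).
Proof.
elim: m => [|m [IHt IHu]].
  by rewrite chebT0 chebU0 hornerC horner0 mul0r cos0 sin0 mulr0.
rewrite -(natr1 m) chebTS chebUS !hornerE IHt [(m%:R + 1) * t]mulrDl mul1r.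
rewrite cosD sinD -IHu.
have := cos2Dsin2 t; rewrite (addrC _ (sin t ^+ 2)) => /(canRL (addrK _)) E.
split; last by ring.
have -> : 1 - cos t * cos t = sin t ^+ 2 by rewrite E expr2.
by ring.
Qed.

Lemma size_cheb m : (size (chebT m) <= m.+1)%N /\ (size (chebU m) <= m)%N.
Proof.
elim: m => [|m [IHt IHu]].
  by rewrite chebT0 chebU0 size_poly1 size_poly0.
have sX2 : (size (1 - 'X ^+ 2 : {poly R})%R <= 3)%N.
  by rewrite (leq_trans (size_polyD _ _))// size_polyN size_polyXn size_poly1.
split; rewrite (chebTS, chebUS).
  rewrite (leq_trans (size_polyD _ _))// geq_max size_polyN.
  rewrite (leq_trans (size_polyMleq _ _)) ?size_polyX//=.
  apply: (leq_trans (size_polyMleq _ _)).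
  by rewrite -subn1 leq_subLR (leq_trans (leq_add sX2 IHu)).
rewrite (leq_trans (size_polyD _ _))// geq_max IHt andbT.
by rewrite (leq_trans (size_polyMleq _ _))// size_polyX.
Qed.

End Chebyshev.

(** * The polynomials R_n and Q_n *)

(** Each sign change gives a root by the intermediate value theorem. Roots are collected from right
    to left: the next one lies below [c m] and all earlier ones above it, hence they stay
    distinct. *)
Lemma alternating_roots {F : rcfType} (p : {poly F}) (c : nat -> F) m :
  (forall j, (j < m)%N -> c j.+1 < c j) ->
  (forall j, (j < m)%N -> p.[c j.+1] * p.[c j] < 0) ->
  exists rs, [/\ size rs = m, uniq rs &
    all (fun x => root p x && (c m < x < c 0%N)) rs].
Proof.
elim: m => [|m IH] dc sp; first by exists [::].
have [||rs [srs urs /allP ars]] := IH.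
- by move=> j jm; apply: dc; rewrite ltnW.
- by move=> j jm; apply: sp; rewrite ltnW.
have [y] := poly_ivtoo (ltW (dc m (ltnSn m))) (sp m (ltnSn m)).
rewrite in_itv/= => /andP[y1 y2] ry.
have cm0 : c m <= c 0%N.
  elim: {-2}m (leqnn m) => // k IHk km.
  by rewrite (le_trans _ (IHk (ltnW km)))// ltW// dc// ltnW.
exists (y :: rs); split; first by rewrite /= srs.
  rewrite /= urs andbT; apply/negP => /ars /and3P[_ h _].
  by move: (lt_trans y2 h); rewrite ltxx.
rewrite /= ry y1 (lt_le_trans y2 cm0) /=; apply/allP => x /ars /and3P[-> h ->].
by rewrite (lt_trans (dc _ (ltnSn m)) h).
Qed.

Section ChebyshevForm.
Context {R : realType} (a : R) (ha : 0 < a).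
Implicit Types (m : nat) (x : R).

Local Notation s := (Num.sqrt (a ^+ 2 + 1)).
Local Notation b := (a / s).

Lemma sqr_s : s ^+ 2 = a ^+ 2 + 1.
Proof. by rewrite sqr_sqrtr// addr_ge0 ?sqr_ge0. Qed.

Lemma s_gt0 : 0 < s.
Proof. by rewrite sqrtr_gt0 addr_gt0 ?exprn_gt0. Qed.

Lemma s_neq0 : s != 0. Proof. by rewrite gt_eqF ?s_gt0. Qed.

Lemma b_gt0 : 0 < b. Proof. by rewrite divr_gt0 ?s_gt0. Qed.

Lemma Rpoly0 : Rpoly a 0 = b%:P. Proof. by []. Qed.

Lemma Rpoly1 : Rpoly a 1 = ((a + s) / s) *: 'X. Proof. by []. Qed.

Lemma RpolySS m : Rpoly a m.+2 = 2%:R *: 'X * Rpoly a m.+1 - Rpoly a m.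
Proof. by []. Qed.

(** Both sides satisfy the same three-term recurrence, so agreement at the indices 0 and 1
    suffices. *)
Lemma RpolyE m : Rpoly a m = b%:P * chebT m + 'X * chebU m.
Proof.
suff: Rpoly a m = b%:P * chebT m + 'X * chebU m /\
  Rpoly a m.+1 = b%:P * chebT m.+1 + 'X * chebU m.+1 by case.
elim: m => [|m [IH0 IH1]].
  rewrite Rpoly0 Rpoly1 chebTS chebUS chebT0 chebU0 mulrDl divff ?s_neq0//.
  by rewrite scalerDl scale1r -mul_polyC; split; ring.
split=> //; rewrite RpolySS IH0 IH1 chebTSS chebUSS -mul_polyC.
by rewrite (_ : 2%:R%:P = 2%:R :> {poly R}) ?raddfMn//=; ring.
Qed.

Lemma size_Rpoly m : (size (Rpoly a m) <= m.+1)%N.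
Proof.
have [sT sU] := @size_cheb R m.
rewrite RpolyE (leq_trans (size_polyD _ _))// geq_max.
rewrite mul_polyC (leq_trans (size_scale_leq _ _))//=.
by rewrite (leq_trans (size_polyMleq _ _))// size_polyX.
Qed.

(* If T_m(x)^2 = 1 then, by Pell's identity, U_(m-1)(x) = 0 or x^2 = 1; in the
   latter case x U_(m-1)(x) = m T_m(x). *)
Lemma Rpoly_extremum m x : (chebT m).[x] ^+ 2 = 1 ->
  exists2 c, 0 < c & (Rpoly a m).[x] = c * (chebT m).[x].
Proof.
move=> T2.
have /(congr1 (horner^~ x)) := @cheb_pell R m.
rewrite /= !hornerE T2 -[RHS]addr0 => /addrI /eqP.
have [_ /(congr1 (horner^~ x))] := @cheb_deriv R m.
rewrite RpolyE /= !hornerE !mulf_eq0 -orbA orbb => D /orP[]/eqP H.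
  exists (b + m%:R); first by rewrite ltr_wpDr ?b_gt0.
  move: D; rewrite H mul0r => /esym/eqP; rewrite subr_eq0 => /eqP ->.
  by rewrite -polyC_natr hornerC mulrDl.
exists b; first exact: b_gt0.
by rewrite H mulr0 addr0.
Qed.

Lemma cos_pi_mul (j : nat) : cos (j%:R * pi) = (-1) ^+ j :> R.
Proof.
elim: j => [|j IH]; first by rewrite mul0r cos0.
by rewrite -natr1 mulrDl mul1r cosDpi IH exprS mulN1r.
Qed.

(** For m > 0, T_m = (-1)^j at the extremal points cos (j pi / m), and by [Rpoly_extremum] R_m has
    the same sign there; the m sign changes yield m zeros. *)
Lemma Rpoly_roots m : exists rs, [/\ size rs = m, uniq rs &
  all (fun x => root (Rpoly a m) x && (-1 < x < 1)) rs].
Proof.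
case: m => [|m]; first by exists [::].
pose c j : R := cos (j%:R * pi / m.+1%:R).
have c0 : c 0%N = 1 by rewrite /c !mul0r cos0.
have cm : c m.+1 = -1 by rewrite /c mulrC mulKf ?pnatr_eq0// cospi.
have := @alternating_roots R (Rpoly a m.+1) c m.+1.
rewrite c0 cm; apply=> j jm.
  have ang k : (k <= m.+1)%N -> (k%:R * pi / m.+1%:R : R) \in `[0, pi].
    move=> km; rewrite in_itv/= divr_ge0 ?mulr_ge0 ?pi_ge0//=.
    by rewrite ler_pdivrMr// mulrC ler_pM2l ?pi_gt0// ler_nat.
  rewrite /c ltr_cos ?ang ?(ltnW jm)//.
  by rewrite ltr_pM2r ?invr_gt0// ltr_pM2r ?pi_gt0// ltr_nat.
have Tc k : (chebT m.+1).[c k] = (-1) ^+ k.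
  by rewrite (cheb_cos _ _).1 mulrC divfK ?pnatr_eq0// cos_pi_mul.
have T2 k : (chebT m.+1).[c k] ^+ 2 = 1 by rewrite Tc sqrr_sign.
have [d0 d0p ->] := Rpoly_extremum (T2 j.+1).
have [d1 d1p ->] := Rpoly_extremum (T2 j).
rewrite mulrACA !Tc -exprD addSn addnn -signr_odd /= odd_double mulrN1 oppr_lt0.
exact: mulr_gt0.
Qed.

(** At 1 = cos 0 the value of T_m is 1, so R_m is positive there by [Rpoly_extremum]. *)
Lemma Rpoly_neq0 m : Rpoly a m != 0.
Proof.
have [|c c0 E] := @Rpoly_extremum m 1.
  by rewrite -cos0 (cheb_cos _ _).1 mulr0 cos0 expr1n.
apply/eqP => R0; move: E; rewrite R0 horner0 -cos0 (cheb_cos _ _).1 mulr0 cos0.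
by rewrite mulr1 => E; rewrite -E ltxx in c0.
Qed.

(** Since the degree is at most m, the m zeros found in [Rpoly_roots] exhaust the roots, and
    [rootsR] lists exactly these. *)
Lemma rootsR_Rpoly m :
  [/\ size (rootsR (Rpoly a m)) = m, uniq (rootsR (Rpoly a m)),
    all (fun x => root (Rpoly a m) x && (-1 < x < 1)) (rootsR (Rpoly a m)) &
    exists2 c, c != 0 &
      Rpoly a m = c *: \prod_(x <- rootsR (Rpoly a m)) ('X - x%:P)].
Proof.
have [rs [srs urs /allP ars]] := Rpoly_roots m.
set p := Rpoly a m in ars *.
have onR x : (x \in rootsR p) = root p x.
  by rewrite -(roots_on_rootsR (Rpoly_neq0 m)) in_itv.
have uR : uniq (rootsR p) by exact: uniq_roots.
have aR : all (root p) (rootsR p) by apply/allP => x; rewrite onR.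
have lt_sz := max_poly_roots (Rpoly_neq0 m) aR uR.
have sR : (size (rootsR p) <= size rs)%N.
  by rewrite srs -ltnS (leq_trans lt_sz) ?size_Rpoly.
have sub : {subset rs <= rootsR p} by move=> x /ars /andP[+ _]; rewrite onR.
have [szE memE] := uniq_min_size urs sub sR.
split=> //; first by rewrite -szE srs.
  by apply/allP => x; rewrite -memE => /ars.
exists (lead_coef p); first by rewrite lead_coef_eq0 Rpoly_neq0.
apply: all_roots_prod_XsubC => //; last by rewrite uniq_rootsE.
by apply/eqP; rewrite eqn_leq lt_sz -szE srs size_Rpoly.
Qed.

End ChebyshevForm.

Definition horner_ringE :=
  (hornerD, hornerN, hornerM, hornerC, hornerX, hornerXn).

Section GrowthPolynomial.
Context {R : realType} (a : R) (ha : 0 < a).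
Implicit Types (m : nat) (x : R).

Local Notation s := (Num.sqrt (a ^+ 2 + 1)).
Local Notation b := (a / s).
Local Notation toC := (real_complex R).
Local Notation ii := (('i)%C : R[i]).

Lemma cheb_pell_at m x :
  (chebT m).[x] ^+ 2 + (1 - x ^+ 2) * (chebU m).[x] ^+ 2 = 1.
Proof.
by move: (congr1 (horner^~ x) (@cheb_pell R m)); rewrite /= !horner_ringE.
Qed.

(** The index is that of T_m: [ReQ m] and [ImQ m] are the real and imaginary parts of Q_(m+1) on the
    real line. *)
Definition ReQ m : {poly R} :=
  (1 - 'X ^+ 2) * chebU m - b%:P * 'X * chebT m.

Definition ImQ m : {poly R} := - (s^-1)%:P * chebT m.

Lemma ReQSS m : ReQ m.+2 = 2%:R * 'X * ReQ m.+1 - ReQ m.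
Proof. by rewrite /ReQ chebTSS chebUSS; ring. Qed.

Lemma ImQSS m : ImQ m.+2 = 2%:R * 'X * ImQ m.+1 - ImQ m.
Proof. by rewrite /ImQ chebTSS; ring. Qed.

Lemma QpolySSS m : Qpoly a m.+3 = 2%:R *: 'X * Qpoly a m.+2 - Qpoly a m.+1.
Proof. by []. Qed.

Lemma QpolyE m :
  Qpoly a m.+1 = map_poly toC (ReQ m) + ii%:P * map_poly toC (ImQ m).
Proof.
suff: Qpoly a m.+1 = map_poly toC (ReQ m) + ii%:P * map_poly toC (ImQ m) /\
  Qpoly a m.+2 = map_poly toC (ReQ m.+1) + ii%:P * map_poly toC (ImQ m.+1).
  by case.
elim: m => [|m [IH0 IH1]].
  have sV : ((s%:C)%C^-1)%:P * ((s%:C)%C)%:P = 1 :> {poly R[i]}.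
    by rewrite -polyCM mulVf// eq_complex /= negb_and s_neq0.
  have sVE : (s^-1)%:C%C = (s%:C)%C^-1 by rewrite fmorphV.
  rewrite /Qpoly /ReQ /ImQ !(chebTS, chebUS) chebT0 chebU0.
  rewrite !(rmorphB, rmorphD, rmorphM, rmorphN, rmorphXn, rmorph1, rmorph0)/=.
  rewrite !map_polyC map_polyX /= sVE -!mul_polyC.
  rewrite !(rmorphN, rmorphD, polyCM) /=.
  by split; [ring|ring: sV].
split=> //; rewrite QpolySSS IH0 IH1 ReQSS ImQSS -mul_polyC.
rewrite (_ : 2%:R%:P = 2%:R :> {poly R[i]}) ?raddfMn//=.
rewrite !(rmorphB, rmorphM, rmorph_nat)/= map_polyX; ring.
Qed.

Lemma Qpoly_real m x :
  (Qpoly a m.+1).[(x%:C)%C] = ((ReQ m).[x] +i* (ImQ m).[x])%C.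
Proof.
by rewrite QpolyE hornerD hornerM hornerC !horner_map /= [RHS]complexE.
Qed.

Lemma size_Qpoly m : (size (Qpoly a m.+1) <= m.+2)%N.
Proof.
suff: (size (Qpoly a m.+1) <= m.+2)%N /\ (size (Qpoly a m.+2) <= m.+3)%N.
  by case.
have sC (c : R[i]) k (p : {poly R[i]}) :
  (size p <= k)%N -> (size (c *: p) <= k)%N.
  by apply: leq_trans; exact: size_scale_leq.
have sD k (p q : {poly R[i]}) :
  (size p <= k)%N -> (size q <= k)%N -> (size (p + q)%R <= k)%N.
  by move=> *; rewrite (leq_trans (size_polyD _ _))// geq_max; apply/andP.
elim: m => [|m [IH0 IH1]].
  split; rewrite /Qpoly ?size_polyN; apply/sC; apply/sD;
    rewrite ?(leq_trans (size_polyC_leq1 _))//.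
    by apply/sC; rewrite size_polyX.
  apply/sD; first by apply/sC; rewrite size_polyXn.
  by rewrite size_polyN; apply/sC; rewrite size_polyX.
split=> //; rewrite QpolySSS; apply/sD; last first.
  by rewrite size_polyN (leq_trans IH0 (leq_addl 2 _)).
rewrite -scalerAl; apply/sC.
by rewrite (leq_trans (size_polyMleq _ _))// size_polyX.
Qed.

Lemma node_relation m x :
  x * (ReQ m).[x] - a * (ImQ m).[x] = (1 - x ^+ 2) * (Rpoly a m).[x].
Proof.
by rewrite RpolyE// /ReQ /ImQ !horner_ringE; ring.
Qed.

(** The cross terms in T U cancel and b^2 + s^-2 = 1, which leaves Pell's identity. *)
Lemma Q_pythagoras m x :
  (ReQ m).[x] ^+ 2 + (ImQ m).[x] ^+ 2 + (1 - x ^+ 2) * (Rpoly a m).[x] ^+ 2 = 1.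
Proof.
have P := cheb_pell_at m x.
have S : b ^+ 2 + s^-1 ^+ 2 = 1.
  have s0 := s_neq0 ha.
  transitivity ((a ^+ 2 + 1) / s ^+ 2); first by field.
  by rewrite -{1}sqr_s divff// expf_neq0.
rewrite RpolyE// /ReQ /ImQ !horner_ringE -[RHS]P.
transitivity ((b ^+ 2 + s^-1 ^+ 2) * (chebT m).[x] ^+ 2
              + (1 - x ^+ 2) * (chebU m).[x] ^+ 2); first by ring.
by rewrite S mul1r.
Qed.

Definition node_poly m : {poly R} := (1 - 'X ^+ 2) * Rpoly a m.

(** If x^2 = 1, the product equals 2 b (b + m). At a zero of R_m, x U = - b T turns Re Q into U and
    the product into U^2 + b m; here U is nonzero, since U = 0 would force T = 0, against Pell's
    identity. *)
Lemma node_deriv_sign m x : x ^+ 2 = 1 \/ root (Rpoly a m) x ->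
  0 < (ReQ m).[x] * (node_poly m)^`().[x].
Proof.
have P := cheb_pell_at m x.
have b0 : 0 < b := b_gt0 ha.
(* The derivative of U enters only through (1 - x^2) U', which [cheb_deriv] eliminates. *)
have -> : (node_poly m)^`().[x] =
    (1 - x ^+ 2) * ((b * m%:R + 1) * (chebU m).[x])
    - 2%:R * x * (Rpoly a m).[x]
    + x * (x * (chebU m).[x] - m%:R * (chebT m).[x]).
  rewrite /node_poly derivM derivB derivXn derivC RpolyE// derivD !derivM.
  rewrite derivC derivX (cheb_deriv m).1 hornerD.
  have := congr1 (horner^~ x) (@cheb_deriv R m).2.
  rewrite /= -!polyC_natr !horner_ringE => <-.
  by ring.
have := congr1 (horner^~ x) (@cheb_deriv R m).2.
rewrite /root RpolyE// /ReQ /= -polyC_natr !horner_ringE -!(expr2 x).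
move: (chebT m).[x] (chebU m).[x] (chebU m)^`().[x] P.
move=> T U U' P DU [x2|/eqP RT].
  move: DU P; rewrite x2 subrr !mul0r addr0 => /esym/subr0_eq xU T2.
  rewrite xU subrr mulr0 add0r addr0 !sub0r.
  suff -> : - (b * x * T) * - (2%:R * x * (b * T + m%:R * T))
      = 2%:R * b * (b + m%:R).
    by rewrite mulr_gt0 ?(mulr_gt0 _ b0)// ltr_wpDr.
  transitivity (2%:R * b * (b + m%:R) * (x ^+ 2 * T ^+ 2)); first by ring.
  by rewrite x2 T2 !mulr1.
have xU : x * U = - (b * T) by apply/eqP; rewrite -addr_eq0 addrC RT.
have AU : (1 - x ^+ 2) * U - b * x * T = U.
  transitivity ((1 - x ^+ 2) * U + x * - (b * T)); first by ring.
  by rewrite -xU; ring.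
rewrite RT AU mulr0 subr0.
have -> : U * ((1 - x ^+ 2) * ((b * m%:R + 1) * U) + x * (x * U - m%:R * T)) =
   U ^+ 2 + b * m%:R * (T ^+ 2 + (1 - x ^+ 2) * U ^+ 2).
  transitivity ((1 - x ^+ 2) * (b * m%:R + 1) * U ^+ 2 + x ^+ 2 * U ^+ 2
     - m%:R * T * (x * U)); first by ring.
  by rewrite xU; ring.
rewrite P mulr1; apply: ltr_wpDr; first by rewrite mulr_ge0 ?(ltW b0).
rewrite exprn_even_gt0//=.
apply/eqP => U0; move: RT P; rewrite U0 mulr0 addr0 expr0n mulr0 addr0.
move=> /eqP; rewrite mulf_eq0 (gt_eqF b0) /= => /eqP ->; rewrite expr0n => /eqP.
by rewrite eq_sym oner_eq0.
Qed.

Lemma z0E : z0_of a = ii * (a%:C)%C.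
Proof. by rewrite [LHS]complexE /= rmorph0 add0r. Qed.

(** At z_0 = ai the factor 2z is 2ai and - i^m = i^(m+2), so the recurrence becomes rho_(m+2) = 2 a
    rho_(m+1) + rho_m, which preserves positivity. *)
Lemma Rpoly_imag m : exists2 rho : R, 0 < rho &
  (map_poly toC (Rpoly a m)).[z0_of a] = ii ^+ m * (rho%:C)%C.
Proof.
pose P k (c : R) := (map_poly toC (Rpoly a k)).[z0_of a] = ii ^+ k * (c%:C)%C.
suff [c0 [c1 [+ _]]] :
    exists c0 c1, (0 < c0 /\ P m c0) /\ (0 < c1 /\ P m.+1 c1).
  by case=> c00 E; exists c0.
have i2 : ii ^+ 2 = -1 := sqr_i _.
elim: m => [|m [c0 [c1 [[c00 E0] [c10 E1]]]]].
  exists b, ((a + s) / s * a); split; split.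
  - exact: b_gt0.
  - by rewrite /P Rpoly0 map_polyC hornerC mul1r.
  - by rewrite mulr_gt0// divr_gt0 ?addr_gt0 ?s_gt0.
  - rewrite /P Rpoly1 -mul_polyC rmorphM/= map_polyC map_polyX !horner_ringE.
    by rewrite z0E /= !rmorphM /= expr1; ring.
exists c1, (2%:R * a * c1 + c0); split=> //; split.
  by rewrite addr_gt0// !mulr_gt0.
have two : (2%:R%:C)%C = 2%:R :> R[i] by exact: (rmorph_nat toC).
have cE : ((2%:R * a * c1 + c0)%:C)%C
    = 2%:R * (a%:C)%C * (c1%:C)%C + (c0%:C)%C :> R[i].
  by rewrite -two -!(rmorphM toC) -(rmorphD toC).
rewrite /P RpolySS -mul_polyC rmorphB !rmorphM /= map_polyC map_polyX.
rewrite !horner_ringE [X in _ * X - _]E1 [X in _ - X]E0 z0E /= two cE.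
rewrite !exprS; ring: i2.
Qed.

End GrowthPolynomial.

(** * Nodes and Lagrange polynomials *)

(** Allows the sampling points of index n and beyond to be changed freely, as is done in
    [sample]. *)
Lemma eq_lagrange {K : fieldType} n (x y : nat -> K) :
  (forall j : 'I_n, x j = y j) -> lagrange n x = lagrange n y.
Proof.
move=> xy; rewrite [lagrange _ x]unlock [lagrange _ y]unlock.
apply: eq_from_tnth => i; rewrite !tnth_map tnth_ord_tuple /= xy.
have -> // : \prod_(j < n | j != i) ('X - (x j)%:P) =
  \prod_(j < n | j != i) ('X - (y j)%:P).
by apply: eq_bigr => j _; rewrite xy.
Qed.

Section Nodes.
Context {R : realType} (a : R) (ha : 0 < a) (m : nat).

Local Notation toC := (real_complex R).
Local Notation ii := (('i)%C : R[i]).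
Local Notation x_ := (node a m.+1).
Local Notation xC_ j := ((x_ j)%:C)%C.

Let S := -1 :: rcons (rootsR (Rpoly a m)) 1.

Let sizeS : size S = m.+2.
Proof. by have [h _ _ _] := rootsR_Rpoly ha m; rewrite /= size_rcons h. Qed.

Lemma node_inj j k : (j < m.+2)%N -> (k < m.+2)%N -> x_ j = x_ k -> j = k.
Proof.
move=> jm km /eqP; rewrite nth_uniq ?sizeS//; first by move/eqP.
have [_ u /allP rI _] := rootsR_Rpoly ha m.
rewrite /S /= mem_rcons inE negb_or rcons_uniq u andbT -andbA.
apply/and3P; split.
- by rewrite eqNr oner_eq0.
- by apply/negP => /rI/and3P[_]; rewrite ltxx.
- by apply/negP => /rI/and3P[_ _]; rewrite ltxx.
Qed.

Lemma node_prop j : (j < m.+2)%N ->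
  (x_ j ^+ 2 = 1 \/ root (Rpoly a m) (x_ j)) /\ -1 <= x_ j <= 1.
Proof.
move=> jm; have : x_ j \in S by rewrite mem_nth ?sizeS.
have [_ _ /allP rI _] := rootsR_Rpoly ha m.
rewrite inE mem_rcons inE => /or3P[/eqP->|/eqP->|/rI/and3P[r l1 l2]].
- by rewrite sqrrN expr1n lexx; split; [left|lra].
- by rewrite expr1n lexx; split; [left|lra].
- by rewrite !ltW//; split; [right|].
Qed.

Lemma node_poly_factor : exists2 c, c != 0 &
  node_poly a m = c *: \prod_(j < m.+2) ('X - (x_ j)%:P).
Proof.
have [_ _ _ [c c0 E]] := rootsR_Rpoly ha m.
exists (- c); first by rewrite oppr_eq0.
rewrite -(big_mkord xpredT (fun j => 'X - (x_ j)%:P)) -sizeS.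
rewrite -(big_nth 1 xpredT (fun x => 'X - x%:P)) /S big_cons -cats1 big_cat.
rewrite big_seq1 /node_poly {1}E /= -!mul_polyC !polyCN polyC1; ring.
Qed.

(* [node] is constant beyond the last node, whereas the library's Lagrange
   lemmas need sampling points that are injective on all of [nat]. *)
Definition sample (j : nat) : R[i] :=
  if (j < m.+2)%N then xC_ j else ((j%:R)%:C)%C.

Lemma sampleE (j : 'I_m.+2) : sample j = xC_ j.
Proof. by rewrite /sample ltn_ord. Qed.

Lemma sample_inj : injective sample.
Proof.
(* Nodes are at most 1, whereas the padding values are at least m + 2. *)
have out j k : (j < m.+2)%N -> (k < m.+2)%N = false -> x_ j <> k%:R.
  move=> jm /negbT; rewrite -leqNgt => km E.
  have [_ /andP[_]] := node_prop jm.
  by rewrite E lern1 => k1; move: (leq_trans km k1).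
move=> j k; rewrite /sample.
case: ifPn => [jm|/negbTE jm]; case: ifPn => [km|/negbTE km] [E].
- exact: node_inj E.
- by case: (out _ _ jm km).
- by case: (out _ _ km jm).
- by apply/eqP; rewrite -(eqr_nat R) E.
Qed.

Lemma ell_lagrange k : ell a k = tnth (lagrange m.+2 sample) k.
Proof. by congr (tnth _ k); apply: eq_lagrange => j; rewrite sampleE. Qed.

Lemma ell_node (k j : 'I_m.+2) :
  (ell a k : {poly R[i]}).[xC_ j] = (k == j)%:R.
Proof.
by rewrite ell_lagrange -sampleE lagrange_sample//; exact: sample_inj.
Qed.

Lemma ell_interpolation (p : {poly R[i]}) : (size p <= m.+2)%N ->
  p = \sum_(k < m.+2) p.[xC_ k] *: (ell a k : {poly R[i]}).
Proof.
move=> sp; rewrite {1}(lagrange_gen _ sample_inj sp)//.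
by apply: eq_bigr => k _; rewrite mul_polyC ell_lagrange sampleE.
Qed.

(** With W = [node_poly a m], the classical formula l_k(z) (z - x_k) W'(x_k) = W(z) applies, and
    W(ai) = (1 + a^2) R_m(ai) is given by [Rpoly_imag]. *)
Lemma ell_z0 (k : 'I_m.+2) : exists2 rho : R, 0 < rho &
  (ell a k : {poly R[i]}).[z0_of a] * (z0_of a - xC_ k)
    * ((node_poly a m)^`().[x_ k]%:C)%C = ii ^+ m * (rho%:C)%C.
Proof.
have [rho rho0 Erho] := Rpoly_imag ha m.
have [c c0 Ec] := node_poly_factor.
pose p : {poly R} := \prod_(j < m.+2 | j != k) ('X - (x_ j)%:P).
have {}Ec : node_poly a m = c *: (('X - (x_ k)%:P) * p) by rewrite Ec (bigD1 k).
have pC : \prod_(j < m.+2 | j != k) ('X - (sample j)%:P) = map_poly toC p.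
  rewrite rmorph_prod; apply: eq_bigr => j _.
  by rewrite rmorphB /= map_polyX map_polyC sampleE.
have Dk : (node_poly a m)^`().[x_ k] = c * p.[x_ k].
  rewrite Ec derivZ hornerZ derivM derivB derivX derivC subr0 mul1r.
  by rewrite hornerD hornerM hornerXsubC subrr mul0r addr0.
have pk0 : p.[x_ k] != 0.
  rewrite horner_prod; apply/prodf_neq0 => j jk; rewrite hornerXsubC subr_eq0.
  by apply: contraNneq jk => xkj; apply/eqP/val_inj/esym; exact: node_inj xkj.
exists ((a ^+ 2 + 1) * rho); first by rewrite mulr_gt0// ltr_wpDl ?sqr_ge0.
rewrite ell_lagrange lagrangeE//; last exact: sample_inj.
rewrite /= sampleE pC horner_map /= hornerCM Dk rmorphM /=.
have z2 : z0_of a ^+ 2 = - (a ^+ 2)%:C%C.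
  by rewrite z0E exprMn sqr_i mulN1r rmorphXn.
have := congr1 (fun q => (map_poly toC q).[z0_of a]) Ec.
rewrite /node_poly /= -mul_polyC !(rmorphM, rmorphB, rmorph1) /= !map_polyC.
rewrite map_polyX !horner_ringE Erho -expr2 z2 /= => E.
have pkC0 : ((p.[x_ k])%:C)%C != 0 by rewrite fmorph_eq0.
rewrite rmorphD rmorph1.
transitivity ((c%:C)%C * ((z0_of a - xC_ k) * (map_poly toC p).[z0_of a])).
  by field.
by rewrite -E; ring.
Qed.

End Nodes.

(** * Extremal growth *)

Section ComplexFacts.
Context {R : realType}.
Local Notation ii := (('i)%C : R[i]).

Lemma normcE (z : R[i]) : ((Normc.normc z)%:C)%C = `|z|.
Proof. by []. Qed.

Lemma conjC_i : ii^* = - ii.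
Proof. by apply/eqP; rewrite eq_complex /= oppr0 !eqxx. Qed.

Lemma conjC_real (x : R) : ((x%:C)%C)^* = (x%:C)%C.
Proof. by apply/eqP; rewrite eq_complex /= oppr0 !eqxx. Qed.

Lemma normC_i : `|ii| = 1.
Proof. by rewrite -normcE /= expr0n expr1n add0r sqrtr1. Qed.

Lemma supnorm_le1P (p : {poly R[i]}) :
  (supnorm segment11 p <= 1)%E <->
  forall x : R, -1 <= x <= 1 -> `|p.[(x%:C)%C]| <= 1.
Proof.
have nE z : (`|z : R[i]| <= 1) = (Normc.normc z <= 1) by rewrite -normcE lecR.
split=> [h x x1|h].
  rewrite nE -lee_fin; apply: le_trans h; apply: ereal_sup_ubound.
  by exists (x%:C)%C => //; exists x => //=; rewrite in_itv.
apply: ge_ereal_sup => _ [_ [x + <-] <-]; rewrite /= in_itv/= => /h.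
by rewrite nE lee_fin.
Qed.

End ComplexFacts.

Section Extremality.
Context {R : realType} (a : R) (ha : 0 < a) (m : nat).

Local Notation ii := (('i)%C : R[i]).
Local Notation x_ := (node a m.+1).
Local Notation xC_ j := ((x_ j)%:C)%C.
Local Notation z0 := (z0_of a).
Local Notation L k := ((ell a k : {poly R[i]}).[z0]).

(** Conjugating [ell_z0] exhibits the left side as t Q_n(x_k) with t > 0; as |Q_n(x_k)| = 1, taking
    moduli gives t = |l_k(z_0)|, which is therefore positive. *)
Lemma Qpoly_node (k : 'I_m.+2) :
  0 < ell_abs a k /\
  - ii ^+ m.+1 * (L k)^* = ((ell_abs a k)%:C)%C * (Qpoly a m.+1).[xC_ k].
Proof.
have [rho rho0 E] := ell_z0 ha k.
have [Hx _] := node_prop ha (ltn_ord k).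
have AW := node_deriv_sign ha Hx.
have xA := node_relation ha m (x_ k).
have pyth := Q_pythagoras ha m (x_ k).
move: Hx AW xA pyth E; rewrite (Qpoly_real ha).
set x := x_ k; set A := (ReQ a m).[x]; set B := (ImQ a m).[x].
set W := (node_poly a m)^`().[x]; set r := (Rpoly a m).[x].
move=> Hx AW + + E.
have -> : (1 - x ^+ 2) * r ^+ 2 = 0.
  by case: Hx => [->|/eqP r0]; rewrite ?subrr ?mul0r// /r r0 expr0n mulr0.
have -> : (1 - x ^+ 2) * r = 0.
  by case: Hx => [->|/eqP r0]; rewrite ?subrr ?mul0r// /r r0 mulr0.
move=> /subr0_eq xA; rewrite addr0 => pyth.
set Q := (A +i* B)%C.
have QE : Q = (A%:C)%C + ii * (B%:C)%C by rewrite [LHS]complexE.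
have Q1 : `|Q| = 1 by rewrite -normcE /= pyth sqrtr1.
set v := - ii ^+ m.+1 * (L k)^*.
have i2 : ii ^+ 2 = -1 := sqr_i _.
have rW0 : (x ^+ 2 + a ^+ 2) * (A * W) > 0.
  by rewrite mulr_gt0// ltr_wpDl ?sqr_ge0// exprn_gt0.
(* From v (x + i a) W = i rho ([E2] below), multiplication by (x - i a) A and x A = a B give (x^2 +
   a^2) A W v = a rho Q. *)
pose t := a * rho / ((x ^+ 2 + a ^+ 2) * (A * W)).
have t0 : 0 < t by rewrite divr_gt0 ?(mulr_gt0 ha rho0).
have vE : v = (t%:C)%C * Q.
  have E1 : (L k)^* * (- ii * (a%:C)%C - (x%:C)%C) * (W%:C)%C
      = (- ii) ^+ m * (rho%:C)%C.
    have := congr1 Num.conj E.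
    by rewrite !rmorphM rmorphB rmorphXn z0E rmorphM /= !conjC_real !conjC_i.
  have E2 : v * ((x%:C)%C + ii * (a%:C)%C) * (W%:C)%C = ii * (rho%:C)%C.
    transitivity (ii ^+ m.+1 * ((- ii) ^+ m * (rho%:C)%C)).
      by rewrite -E1 /v; ring.
    rewrite exprS mulrA -(mulrA ii) -exprMn mulrN -expr2 i2 opprK expr1n.
    by rewrite mulr1.
  have E3 : v * (((x ^+ 2 + a ^+ 2) * (A * W))%:C)%C =
      (t * ((x ^+ 2 + a ^+ 2) * (A * W)))%:C%C * Q.
    have xAC : (a%:C)%C * (B%:C)%C = (x%:C)%C * (A%:C)%C :> R[i].
      by rewrite -!(rmorphM (real_complex R)) /= xA.
    rewrite /t divfK ?gt_eqF// QE !(rmorphM, rmorphD, rmorphXn) /=.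
    transitivity ((v * ((x%:C)%C + ii * (a%:C)%C) * (W%:C)%C) *
       ((x%:C)%C - ii * (a%:C)%C) * (A%:C)%C); first by ring: i2.
    by rewrite E2; ring: i2 xAC.
  have d0 : ((((x ^+ 2 + a ^+ 2) * (A * W))%:C)%C : R[i]) != 0.
    by rewrite fmorph_eq0 gt_eqF.
  by apply: (mulIf d0); rewrite E3 rmorphM mulrAC.
have tE : t = ell_abs a k.
  apply: (@complexI R); rewrite normcE -(norm_conjC (L k)) -[RHS]mul1r.
  rewrite -[X in X * _](_ : `|- ii ^+ m.+1| = 1) -?normrM -/v.
    by rewrite vE normrM Q1 mulr1 ger0_norm// ler0c ltW.
  by rewrite normrN normrX normC_i expr1n.
by rewrite -tE.
Qed.

(** The Lebesgue function of the nodes at z_0; it is the extremal value |Q_n(z_0)| and the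
    normalisation of the weights. *)
Definition Lambda : R := \sum_(j < m.+2) ell_abs a j.

Lemma ell_abs_gt0 (k : 'I_m.+2) : 0 < ell_abs a k.
Proof. exact: (Qpoly_node k).1. Qed.

Lemma Lambda_gt0 : 0 < Lambda.
Proof.
rewrite /Lambda big_ord_recl ltr_pwDl ?ell_abs_gt0// sumr_ge0// => j _.
exact: ell_abs_ge0.
Qed.

(** By [Qpoly_node] every term Q_n(x_k) l_k(z_0) of the interpolation formula is - i^n |l_k(z_0)|:
    all phases agree. *)
Lemma Qpoly_z0 : (Qpoly a m.+1).[z0] = - ii ^+ m.+1 * (Lambda%:C)%C.
Proof.
rewrite {1}(ell_interpolation ha (size_Qpoly a m)) horner_sum.
rewrite rmorph_sum mulr_sumr; apply: eq_bigr => k _; rewrite hornerZ.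
have [l0 E] := Qpoly_node k.
have lC0 : ((ell_abs a k)%:C)%C != 0 :> R[i] by rewrite fmorph_eq0 gt_eqF.
apply: (mulfI lC0); rewrite mulrA -E -mulrA [_^* * _]mulrC -normCK.
by rewrite -normcE -/(ell_abs a k) /=; ring.
Qed.

Lemma Qpoly_extremal : extremal_growth m.+1 z0 segment11 (Qpoly a m.+1).
Proof.
split; first exact: size_Qpoly.
  apply/supnorm_le1P => x x1.
  rewrite Qpoly_real// -normcE lecR /= -sqrtr1 ler_wsqrtr//.
  rewrite -(Q_pythagoras ha m x) lerDl mulr_ge0 ?sqr_ge0// subr_ge0.
  by move: x1 => /andP[x1 x2]; nra.
move=> p /supnorm_le1P p1.
rewrite -lecR !normcE Qpoly_z0 normrM normrN normrX normC_i expr1n mul1r.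
rewrite [leRHS]ger0_norm; last by rewrite ler0c ltW// Lambda_gt0.
rewrite {1}(ell_interpolation ha (size_npoly p)) horner_sum rmorph_sum.
apply: le_trans (ler_norm_sum _ _ _) _; apply: ler_sum => k _.
rewrite hornerZ normrM /= normcE ler_piMl// p1//.
exact: (node_prop ha (ltn_ord k)).2.
Qed.

End Extremality.

(** * The kernel of the discrete measure *)

(** Integration against sums and multiples of measures is computed for nonnegative functions, then
    applied to the positive and negative parts of f. *)
Lemma Rintegral_msum_dirac d (T : measurableType d) {R : realType} (D : set T)
    (x : nat -> T) (w : nat -> {nonneg R}) n (f : T -> R) :
  measurable D -> measurable_fun D f -> (forall k, (k < n)%N -> D (x k)) ->
  Rintegral (msum (fun k => mscale (w k) (@dirac _ T (x k) R)) n) D f =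
  \sum_(k < n) (w k)%:num * f (x k).
Proof.
move=> mD mf Dx.
have ge0E (g : T -> R) : measurable_fun D g -> (forall t, 0 <= g t) ->
  (\int[msum (fun k => mscale (w k) (@dirac _ T (x k) R)) n]_(t in D) (g t)%:E
   = (\sum_(k < n) (w k)%:num * g (x k))%:E)%E.
  move=> /measurable_EFinP mg g0.
  rewrite ge0_integral_measure_sum//; last by move=> t _; rewrite lee_fin.
  rewrite -sumEFin; apply: eq_bigr => k _.
  rewrite ge0_integral_mscale//; last by move=> t _; rewrite lee_fin.
  by rewrite integral_dirac// diracE mem_set ?mul1e//; apply: Dx.
rewrite /Rintegral integralE funerpos funerneg.
rewrite (ge0E _ (measurable_funrpos mf) (funrpos_ge0 f)).
rewrite (ge0E _ (measurable_funrneg mf) (funrneg_ge0 f)).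
rewrite /= -sumrB; apply: eq_bigr => k _.
by rewrite -mulrBr -[in RHS](funrposBneg f).
Qed.

Section HornerOnReals.
Context {R : realType}.

(** Reduces the two integrands of [inner] to real polynomials, which are measurable. *)
Lemma horner_complex_real (p : {poly R[i]}) : exists p1 p2 : {poly R},
  forall x : R, p.[(x%:C)%C] = (p1.[x] +i* p2.[x])%C.
Proof.
elim/poly_ind: p => [|p c [p1 [p2 E]]].
  by exists 0, 0 => x; rewrite !horner0.
exists (p1 * 'X + (complex.Re c)%:P), (p2 * 'X + (complex.Im c)%:P) => x.
rewrite !hornerMXaddC E [in LHS](complexE c).
apply/eqP; rewrite eq_complex /=.
by rewrite !mul0r !mulr0 !mul1r !subr0 !addr0 !add0r !eqxx.
Qed.

Lemma measurable_horner (p : {poly R}) (D : set R) :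
  measurable_fun (D : set (measurableTypeR R)) (fun x => p.[x]).
Proof.
apply: measurable_funTS; apply: continuous_measurable_fun.
exact: continuous_horner.
Qed.

End HornerOnReals.

Section Kernel.
Context {R : realType} (a : R) (ha : 0 < a) (m : nat).

Local Notation ii := (('i)%C : R[i]).
Local Notation x_ := (node a m.+1).
Local Notation xC_ j := ((x_ j)%:C)%C.
Local Notation z0 := (z0_of a).
Local Notation Lam := (Lambda a m).

Lemma weight_gt0 (k : 'I_m.+2) : 0 < weight a k.
Proof. by rewrite divr_gt0 ?ell_abs_gt0 ?Lambda_gt0. Qed.

Lemma sum_weight : \sum_(k < m.+2) weight a k = 1.
Proof. by rewrite -mulr_suml divff// gt_eqF// (Lambda_gt0 ha m). Qed.

Lemma mu0_nodes (A : set R) :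
  (forall k, (k < m.+2)%N -> A (x_ k)) -> mu0 a m.+1 A = 1%E.
Proof.
move=> Ax; rewrite /mu0 /msum /=.
rewrite -sum_weight -sumEFin; apply: eq_bigr => k _.
rewrite /= /mscale /= diracE mem_set; last exact: Ax.
by rewrite mule1 inord_val.
Qed.

Lemma node_in (k : nat) : (k < m.+2)%N -> `[(-1 : R), 1]%classic (x_ k).
Proof. by move=> km; rewrite /= in_itv/=; exact: (node_prop ha km).2. Qed.

Lemma innerE (p r : {poly R[i]}) : inner (mu0 a m.+1) p r =
  \sum_(k < m.+2) ((weight a k)%:C)%C * (p.[xC_ k] * (r.[xC_ k])^*).
Proof.
have [p1 [p2 pE]] := horner_complex_real p.
have [r1 [r2 rE]] := horner_complex_real r.
have reE x : complex.Re (p.[(x%:C)%C] * (r.[(x%:C)%C])^*)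
    = (p1 * r1 + p2 * r2).[x].
  by rewrite pE rE !horner_ringE /=; ring.
have imE x : complex.Im (p.[(x%:C)%C] * (r.[(x%:C)%C])^*)
    = (p2 * r1 - p1 * r2).[x].
  by rewrite pE rE !horner_ringE /=; ring.
rewrite /inner /cintegral (funext reE) (funext imE).
rewrite !Rintegral_msum_dirac//; try exact: measurable_horner;
  try exact: node_in.
rewrite [LHS]complexE /= !rmorph_sum mulr_sumr -big_split.
apply: eq_bigr => k _; rewrite /= inord_val -reE -imE; set c := _ * _^*.
by rewrite [in RHS](complexE c) !rmorphM /=; ring.
Qed.

(** The inner product is a weighted sum over the nodes, where l_k is a Kronecker delta; as all
    weights are positive, the l_k / sqrt w_k are orthonormal. *)
Lemma exists_orthonormal_basis : exists q : m.+2.-tuple {poly_m.+2 R[i]},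
  orthonormal_basis (mu0 a m.+1) q.
Proof.
pose c (k : 'I_m.+2) : R[i] := ((Num.sqrt (weight a k))%:C)%C^-1.
have c0 k : c k != 0.
  by rewrite invr_eq0 fmorph_eq0 gt_eqF// sqrtr_gt0 weight_gt0.
have [q qE] : exists q : m.+2.-tuple {poly_m.+2 R[i]},
    forall k, tnth q k = c k *: ell a k.
  by exists [tuple c k *: ell a k | k < m.+2] => k; rewrite tnth_mktuple.
have qx (j k : 'I_m.+2) : (tnth q j : {poly R[i]}).[xC_ k] = c j * (j == k)%:R.
  by rewrite qE /= hornerZ ell_node.
exists q; split.
  rewrite basisEfree subvf size_tuple dim_polyn leqnn !andbT.
  (* Evaluating a linear relation at x_k isolates its k-th coefficient. *)
  apply/freeP => u.
  move=> /(congr1 (fun p : {poly_m.+2 R[i]} => p : {poly R[i]})).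
  rewrite (@big_morph _ _ _ 0%R +%R)// => E k.
  have := congr1 (horner^~ (xC_ k)) E.
  rewrite /= horner_sum horner0 (bigD1 k)//= big1 ?addr0.
    rewrite hornerZ -tnth_nth qx eqxx mulr1 => /eqP.
    by rewrite mulf_eq0 (negbTE (c0 k)) orbF => /eqP.
  by move=> j jk; rewrite hornerZ -tnth_nth qx (negbTE jk) !mulr0.
move=> j k; rewrite innerE (bigD1 j)//= big1 ?addr0; last first.
  by move=> l lj; rewrite qx eq_sym (negbTE lj) !(mulr0, mul0r).
rewrite !qx eqxx mulr1.
have [->|_] := eqVneq j k; last by rewrite mulr0 conjC0 !mulr0.
rewrite mulr1 /c -fmorphV conjC_real -!(rmorphM (real_complex R)) -expr2.
by rewrite exprVn sqr_sqrtr ?weight_ge0// divff ?gt_eqF ?weight_gt0.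
Qed.

(* Reproducing property: testing the kernel against [ell a j] gives its values
   at the nodes, hence the kernel itself by interpolation. *)
Lemma CDkernel_node (q : m.+2.-tuple {poly_m.+2 R[i]}) (w : R[i])
    (j : 'I_m.+2) :
  orthonormal_basis (mu0 a m.+1) q ->
  ((weight a j)%:C)%C * CDkernel q w (xC_ j) = (ell a j : {poly R[i]}).[w]^*.
Proof.
case=> qB qo; set p : {poly_m.+2 R[i]} := ell a j.
have pE : p = \sum_(i < m.+2) coord q i p *: tnth q i.
  rewrite {1}(coord_basis qB (memvf p)).
  by apply: eq_bigr => i _; rewrite -tnth_nth.
have hE y : (p : {poly R[i]}).[y] =
    \sum_(i < m.+2) coord q i p * (tnth q i : {poly R[i]}).[y].
  rewrite {1}pE (@big_morph _ _ _ 0%R +%R)// horner_sum.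
  by apply: eq_bigr => i _; rewrite hornerZ.
(* Coordinates in an orthonormal basis are inner products with its vectors; since l_j vanishes at
   the other nodes, only the term at x_j survives. *)
have cE i : coord q i p =
    ((weight a j)%:C)%C * ((tnth q i : {poly R[i]}).[xC_ j])^*.
  transitivity (inner (mu0 a m.+1) p (tnth q i)).
    transitivity (\sum_(l < m.+2) coord q l p *
        inner (mu0 a m.+1) (tnth q l) (tnth q i)).
      rewrite (bigD1 i)//= qo eqxx mulr1 big1 ?addr0// => l li.
      by rewrite qo (negbTE li) mulr0.
    rewrite innerE; under eq_bigr do rewrite innerE mulr_sumr.
    rewrite exchange_big; apply: eq_bigr => k _ /=.
    by rewrite hE mulr_suml mulr_sumr; apply: eq_bigr => l _; ring.
  rewrite innerE (bigD1 j)//= big1 ?addr0; last first.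
    by move=> l lj; rewrite ell_node// eq_sym (negbTE lj) !(mulr0, mul0r).
  by rewrite ell_node// eqxx mul1r.
rewrite hE rmorph_sum mulr_sumr; apply: eq_bigr => i _.
by rewrite cE !rmorphM /= !conjC_real conjCK; ring.
Qed.

(** Both sides are polynomials in z of degree at most n, so it suffices to compare them at the
    nodes. There [CDkernel_node] and [Qpoly_node] apply, with [Lambda] times w_k equal to
    |l_k(z_0)|. *)
Lemma Qpoly_CDkernel (q : m.+2.-tuple {poly_m.+2 R[i]}) (z : R[i]) :
  orthonormal_basis (mu0 a m.+1) q ->
  (Lam%:C)%C * (Qpoly a m.+1).[z] = - ii ^+ m.+1 * CDkernel q z0 z.
Proof.
move=> qo; pose f := \sum_(i < m.+2)
  ((tnth q i : {poly R[i]}).[z0])^* *: (tnth q i : {poly R[i]}).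
have fE y : CDkernel q z0 y = f.[y].
  by rewrite horner_sum; apply: eq_bigr => i _; rewrite hornerZ.
have sf : (size f <= m.+2)%N.
  rewrite (leq_trans (size_sum _ _ _))//; apply/bigmax_leqP => i _.
  by rewrite (leq_trans (size_scale_leq _ _))// size_npoly.
rewrite fE [in LHS](ell_interpolation ha (size_Qpoly a m)).
rewrite [in RHS](ell_interpolation ha sf) !horner_sum !mulr_sumr.
apply: eq_bigr => k _; rewrite !hornerZ !mulrA; congr (_ * _).
have w0 : ((weight a k)%:C)%C != 0 :> R[i].
  by rewrite fmorph_eq0 gt_eqF ?weight_gt0.
apply: (mulfI w0); rewrite -fE [RHS]mulrCA CDkernel_node// (Qpoly_node ha k).2.
rewrite mulrA -(rmorphM (real_complex R)) /weight divfK// gt_eqF//.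
exact: Lambda_gt0.
Qed.

End Kernel.

Theorem proposition4p8 (R : realType) (a : R) (n : nat)
    (ha : 0 < a) (hn : (1 <= n)%N) :
  extremal_growth n (z0_of a) segment11 (Qpoly a n)
  /\ (mu0 a n setT = 1%E /\ mu0 a n `[(-1 : R), 1]%classic = 1%E)
  /\ (exists q : n.+1.-tuple {poly_n.+1 R[i]}, orthonormal_basis (mu0 a n) q)
  /\ (forall q : n.+1.-tuple {poly_n.+1 R[i]}, orthonormal_basis (mu0 a n) q ->
        forall z : R[i],
          (Qpoly a n).[z] = - (('i)%C : R[i]) ^+ n * Pextremal q (z0_of a) z).
Proof.
case: n hn => // m _; split; first exact: Qpoly_extremal.
split; first by split; apply: mu0_nodes => // k; exact: node_in.
split; first exact: exists_orthonormal_basis.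
move=> q qo z; have K y := Qpoly_CDkernel ha y qo.
have L0 : ((Lambda a m)%:C)%C != 0 :> R[i].
  by rewrite fmorph_eq0 gt_eqF// Lambda_gt0.
have i0 : - ('i%C : R[i]) ^+ m.+1 != 0.
  by rewrite oppr_eq0 expf_neq0// -normr_eq0 normC_i oner_eq0.
(* The two formulas for Q_n at z_0 give K(z_0, z_0) = [Lambda]^2, so the normalisation in
   [Pextremal] is division by [Lambda]. *)
have Kz0 : CDkernel q (z0_of a) (z0_of a) = ((Lambda a m)%:C)%C ^+ 2.
  by apply: (mulfI i0); rewrite -K Qpoly_z0//; ring.
rewrite /Pextremal Kz0 sqrCK; last by rewrite ler0c ltW// Lambda_gt0.
by apply: (mulfI L0); rewrite K; field.
Qed.
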